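(* Let $\kappa$ be an infinite cardinal. The set $S=T\cap M_3[\mathcal{F}(\kappa)]$ is a bounded sublattice of the lattice $M_3[\mathcal{F}(\kappa)]$.
   Context: $\mathcal{F}(\kappa)$ is the Boolean lattice of subsets $X\subseteq\kappa$ that are finite or cofinite. For sets $A,B,C$, $\mu(A,B,C)=(A\cap B)\cup(A\cap C)\cup(B\cap C)$. $T=\{(A,B,C)\in\mathcal{F}(\kappa)^3 : C\setminus\mu(A,B,C)\text{ is finite}\}$. A triple is balanced if $A\cap B=A\cap C=B\cap C$; $M_3[\mathcal{F}(\kappa)]$ is the set of balanced triples in $\mathcal{F}(\kappa)^3$, a lattice under the componentwise order with componentwise intersection as meet and join $(A,B,C)\vee(A',B',C')=(U_1\cup m,U_2\cup m,U_3\cup m)$ where $U_1=A\cup A'$, $U_2=B\cup B'$, $U_3=C\cup C'$, $m=\mu(U_1,U_2,U_3)$; its bounds are $(\emptyset,\emptyset,\emptyset)$ and $(\kappa,\kappa,\kappa)$. *)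

(* Defs.v *)
(* MathComp-Analysis classical sets world. The cardinal kappa is modelled
   as an arbitrary infinite type K (the underlying set of kappa). *)
From mathcomp Require Import all_boot.
From mathcomp Require Import boolp classical_sets cardinality.
Set Implicit Arguments. Unset Strict Implicit. Unset Printing Implicit Defensive.
Local Open Scope classical_set_scope.

Definition finCofin (K : Type) (X : set K) : Prop :=
  finite_set X \/ finite_set (~` X).

Definition mu (K : Type) (A B C : set K) : set K :=
  (A `&` B) `|` (A `&` C) `|` (B `&` C).

Definition triple (K : Type) := (set K * set K * set K)%type.

Definition t1 (K : Type) (t : triple K) : set K := t.1.1.
Definition t2 (K : Type) (t : triple K) : set K := t.1.2.
Definition t3 (K : Type) (t : triple K) : set K := t.2.

Definition inF3 (K : Type) (t : triple K) : Prop :=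
  finCofin (t1 t) /\ finCofin (t2 t) /\ finCofin (t3 t).

Definition inT (K : Type) (t : triple K) : Prop :=
  inF3 t /\ finite_set (t3 t `\` mu (t1 t) (t2 t) (t3 t)).

Definition balanced (K : Type) (t : triple K) : Prop :=
  t1 t `&` t2 t = t1 t `&` t3 t /\ t1 t `&` t3 t = t2 t `&` t3 t.

Definition inM3 (K : Type) (t : triple K) : Prop := inF3 t /\ balanced t.

Definition M3meet (K : Type) (t t' : triple K) : triple K :=
  (t1 t `&` t1 t', t2 t `&` t2 t', t3 t `&` t3 t').

Definition M3join (K : Type) (t t' : triple K) : triple K :=
  let U1 := t1 t `|` t1 t' in
  let U2 := t2 t `|` t2 t' in
  let U3 := t3 t `|` t3 t' in
  let m := mu U1 U2 U3 in
  (U1 `|` m, U2 `|` m, U3 `|` m).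

Definition M3bot (K : Type) : triple K := (set0, set0, set0).
Definition M3top (K : Type) : triple K := (setT, setT, setT).

Definition inS (K : Type) (t : triple K) : Prop := inT t /\ inM3 t.

Definition bounded_sublattice_M3 (K : Type) (P : triple K -> Prop) : Prop :=
  (forall t, P t -> inM3 t) /\
  P (M3bot K) /\ P (M3top K) /\
  (forall t t', P t -> P t' -> P (M3meet t t') /\ P (M3join t t')).

(* Main.v *)
Require Import Defs.
From mathcomp Require Import all_boot.
From mathcomp Require Import boolp classical_sets cardinality.
Local Open Scope classical_set_scope.

(* For every triple, C \ μ(A,B,C) = C \ (A ∪ B), so membership in T says that
   this excess of C over A ∪ B is finite.  Finite-cofinite sets are closed
   under the Boolean operations, hence so are the components of meets and
   joins.  In a balanced triple C ∩ (A ∪ B) = A ∩ B, which forces the excess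
   of a meet of balanced triples into the union of their excesses.  The join
   of any two triples is balanced, and since each of its components contains
   m, its excess lies in (C ∪ C') \ (A ∪ A' ∪ B ∪ B'), again inside the union
   of the excesses. *)

Section FinCofin.
Variable K : Type.
Implicit Types X Y Z : set K.

Lemma finCofin0 : finCofin (@set0 K).
Proof. by left; exact: finite_set0. Qed.

Lemma finCofinT : finCofin (@setT K).
Proof. by right; rewrite setCT; exact: finite_set0. Qed.

Lemma finCofinC X : finCofin (~` X) <-> finCofin X.
Proof. by rewrite /finCofin setCK; split=> -[]; [right | left | right | left]. Qed.

Lemma finCofinU X Y : finCofin X -> finCofin Y -> finCofin (X `|` Y).
Proof.
move=> [fX|cX] [fY|cY]; first by left; rewrite finite_setU.
all: by right; rewrite setCU; apply: finite_setI; auto.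
Qed.

Lemma finCofinI X Y : finCofin X -> finCofin Y -> finCofin (X `&` Y).
Proof.
by move=> /finCofinC fX /finCofinC fY; apply/finCofinC; rewrite setCI; exact: finCofinU.
Qed.

Lemma finCofin_mu X Y Z :
  finCofin X -> finCofin Y -> finCofin Z -> finCofin (mu X Y Z).
Proof. by move=> fX fY fZ; do !apply: finCofinU; exact: finCofinI. Qed.

End FinCofin.

Lemma setD_mu (K : Type) (A B C : set K) : C `\` mu A B C = C `\` (A `|` B).
Proof. by apply/funext => x; apply/propext; rewrite /mu /=; tauto. Qed.

Lemma setUI_sub (K : Type) (X Y Z : set K) :
  X `&` Y `<=` Z -> (X `|` Z) `&` (Y `|` Z) = Z.
Proof. by rewrite -setUIl; exact: setUidr. Qed.

Section Triples.
Variable K : Type.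
Implicit Types t : triple K.

Definition excess t : set K := t3 t `\` (t1 t `|` t2 t).

Lemma inTE t : inT t <-> inF3 t /\ finite_set (excess t).
Proof. by rewrite /inT setD_mu. Qed.

Lemma inSE t : inS t <-> inT t /\ balanced t.
Proof. by rewrite /inS /inM3; split=> [[? []] | [[? ?] ?]]. Qed.

Lemma inF3_meet t t' : inF3 t -> inF3 t' -> inF3 (M3meet t t').
Proof. by move=> [fA [fB fC]] [fA' [fB' fC']]; do !split; exact: finCofinI. Qed.

Lemma inF3_join t t' : inF3 t -> inF3 t' -> inF3 (M3join t t').
Proof.
move=> [fA [fB fC]] [fA' [fB' fC']].
have fm : finCofin (mu (t1 t `|` t1 t') (t2 t `|` t2 t') (t3 t `|` t3 t')).
  by apply: finCofin_mu; exact: finCofinU.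
by do !split; apply: finCofinU fm; exact: finCofinU.
Qed.

Lemma balanced_setIU t : balanced t -> t3 t `&` (t1 t `|` t2 t) `<=` t1 t `&` t2 t.
Proof. by move=> [e1 e2] x [Cx [Ax|Bx]]; [rewrite e1 | rewrite e1 e2]. Qed.

Lemma balanced_meet t t' : balanced t -> balanced t' -> balanced (M3meet t t').
Proof.
case: t t' => [[A B] C] [[A' B'] C'].
rewrite /balanced /M3meet /t1 /t2 /t3 /= => -[e1 e2] [e1' e2'].
rewrite (setIACA A A' B B') (setIACA A A' C C') (setIACA B B' C C').
by rewrite e1 e1' e2 e2'.
Qed.

Lemma balanced_join t t' : balanced (M3join t t').
Proof.
rewrite /balanced /M3join /t1 /t2 /t3 /=.
by rewrite !setUI_sub // => x ?; rewrite /mu; [right | left; right | left; left].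
Qed.

Lemma excess_meet_sub t t' : balanced t -> balanced t' ->
  excess (M3meet t t') `<=` excess t `|` excess t'.
Proof.
move=> bt bt' x [[Cx Cx'] nx].
have [ABx|] := pselect ((t1 t `|` t2 t) x); last by left.
have [ABx'|] := pselect ((t1 t' `|` t2 t') x); last by right.
have [Ax Bx] := balanced_setIU _ bt _ (conj Cx ABx).
have [Ax' Bx'] := balanced_setIU _ bt' _ (conj Cx' ABx').
by case: nx; left.
Qed.

Lemma excess_join_sub t t' : excess (M3join t t') `<=` excess t `|` excess t'.
Proof.
case: t t' => [[A B] C] [[A' B'] C'] x.
by rewrite /excess /M3join /t1 /t2 /t3 /=; tauto.
Qed.

Lemma inS_bot : inS (M3bot K).
Proof.
have f0 := finCofin0 K.
apply/inSE; split; last by split.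
apply/inTE; split; first by do !split.
by rewrite /excess /t3 /= set0D; exact: finite_set0.
Qed.

Lemma inS_top : inS (M3top K).
Proof.
have fT := finCofinT K.
apply/inSE; split; last by split.
apply/inTE; split; first by do !split.
by rewrite /excess /t1 /t2 /t3 /= setUid setDv; exact: finite_set0.
Qed.

Lemma inS_meet t t' : inS t -> inS t' -> inS (M3meet t t').
Proof.
move=> /inSE [/inTE [Ft Et] bt] /inSE [/inTE [Ft' Et'] bt'].
apply/inSE; split; last exact: balanced_meet.
apply/inTE; split; first exact: inF3_meet.
by apply: sub_finite_set (excess_meet_sub _ _ bt bt') _; rewrite finite_setU.
Qed.

Lemma inS_join t t' : inS t -> inS t' -> inS (M3join t t').
Proof.
move=> /inSE [/inTE [Ft Et] _] /inSE [/inTE [Ft' Et'] _].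
apply/inSE; split; last exact: balanced_join.
apply/inTE; split; first exact: inF3_join.
by apply: sub_finite_set (excess_join_sub t t') _; rewrite finite_setU.
Qed.

End Triples.

Theorem lemma3p3 (K : Type) (hK : infinite_set [set: K]) :
  bounded_sublattice_M3 (@inS K).
Proof.
split; first by move=> t [].
split; first exact: inS_bot.
split; first exact: inS_top.
by move=> t t' St St'; split; [exact: inS_meet | exact: inS_join].
Qed.
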